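(* Let $\mathcal F$ be the set of all real vectors $(\zeta,\tau,\beta,\nu,\omega,\sigma,\chi,\rho)$ satisfying the constraints (Sec), (McC), (Feed), (Split), (Hex), (Pres) listed in the context, together with $\zeta_{i,j}\in[0,1]$ for $[i,j]\in\mathcal T$, $\chi_{i,j}\in[0,1]$ for $(i,j)\in\mathcal C$ and $\rho_{i,j}\in[0,1]$ for $(i,j)\in\mathcal R$. Then $\mathcal F$ is at least as tight as each of the relaxations CG06, GA10 and TAT19; that is, for every point of $\mathcal F$: (a) setting $\eta_{i,j}=\chi_{i,j}+\rho_{i,j}$ for $[i,j]\in\mathcal T\setminus\{[1,N]\}$ (where $\chi_{i,j}$, resp. $\rho_{i,j}$, is read as $0$ if $(i,j)\notin\mathcal C$, resp. $(i,j)\notin\mathcal R$), the vector $(\zeta,\sigma,\eta)$ satisfies all the constraints of CG06; (b) the vector $(\tau,\beta)$ satisfies all the constraints of GA10; (c) the vector $(\zeta,\chi,\rho)$ satisfies all the constraints of TAT19.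
   Context: Let $N\ge2$ be an integer, $\mathcal T=\{[i,j]:1\le i\le j\le N\}$, $\mathcal P=\mathcal T\setminus\{[i,i]:1\le i\le N\}$, $\mathcal S=\mathcal P\setminus\{[1,N]\}$, $\mathcal C=\{(i,j):1\le i\le j\le N-1\}$ and $\mathcal R=\{(i,j):2\le i\le j\le N\}$. Empty sums are zero. Real variables: $\zeta_{i,j}$ for $[i,j]\in\mathcal T$; $\tau_{i,k,j}$ ($i\le k\le j-1$), $\beta_{i,l,j}$ ($i+1\le l\le j$) and $\sigma_{i,k,l,j}$ ($i\le k\le j-1$, $i+1\le l\le k+1$) for $[i,j]\in\mathcal P$; $\nu_{i,k,j}$ for $1\le i\le k\le j\le N$ and $\omega_{i,l,j}$ for $1\le i\le l\le j\le N$; $\chi_{i,j}$ for $(i,j)\in\mathcal C$; $\rho_{i,j}$ for $(i,j)\in\mathcal R$. Conventions: $\nu_{i,n,m}:=1$ if $n=m+1$, and $\omega_{n,m,j}:=1$ if $n=m+1$. In addition, $\tau_{i,j,N+1}:=\nu_{i,j+1,N}-\nu_{i,j,N}$ and $\beta_{0,i,j}:=\omega_{1,i-1,j}-\omega_{1,i,j}$ for $[i,j]\in\mathcal T$. Constraints of the paper's formulation. (Sec) For all $[i,j]\in\mathcal P$: $\tau_{i,k,j}=\nu_{i,k+1,j-1}-\nu_{i,k,j-1}-\nu_{i,k+1,j}+\nu_{i,k,j}$ for $i\le k\le j-1$; and $\beta_{i,l,j}=\omega_{i+1,l-1,j}-\omega_{i,l-1,j}-\omega_{i+1,l,j}+\omega_{i,l,j}$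 for $i+1\le l\le j$. (McC) $\nu_{i,j,j}=\omega_{i,i,j}=1-\zeta_{i,j}$ for all $[i,j]\in\mathcal T$. For all $[i,j]\in\mathcal P$: $\max\{0,\nu_{i,k,m}+\nu_{i,n,j}-\nu_{i,n,m}\}\le\nu_{i,k,j}\le\min\{\nu_{i,k,m},\nu_{i,n,j}\}$ for all $i\le k\le j-1$, $k\le m\le j-1$, $k+1\le n\le m+1$; and $\max\{0,\omega_{i,m,j}+\omega_{n,l,j}-\omega_{n,m,j}\}\le\omega_{i,l,j}\le\min\{\omega_{i,m,j},\omega_{n,l,j}\}$ for all $i+1\le l\le j$, $i\le m\le l-1$, $i+1\le n\le m+1$. (Feed) $\zeta_{1,N}=1$ and $\zeta_{i,i}=1$ for $i=1,\dots,N$. (Split) For all $[i,j]\in\mathcal P$: $\sum_{l=i+1}^{k+1}\sigma_{i,k,l,j}=\tau_{i,k,j}$ for $i\le k\le j-1$; $\sum_{k=l-1}^{j-1}\sigma_{i,k,l,j}=\beta_{i,l,j}$ for $i+1\le l\le j$; $\sigma_{i,k,l,j}\ge0$ for $i\le k\le j-1$, $i+1\le l\le k+1$. (Hex) $\chi_{i,j}\le\beta_{0,i,j}$ for $(i,j)\in\mathcal C$; $\rho_{i,j}\le\tau_{i,j,N+1}$ for $(i,j)\in\mathcal R$; $\chi_{i,i}\ge\beta_{0,i,i}$ for $(i,i)\in\mathcal C$; $\rho_{i,i}\ge\tau_{i,i,N+1}$ for $(i,i)\in\mathcal R$. (Pres) $\beta_{0,i,j}\le\sum_{n=j+1}^{N}\tau_{i,j,n}$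 for all $[i,j]\in\mathcal T\setminus\{[1,N]\}$. Shorthand: $D_{i,j}=\sum_{n=j+1}^{N}\sum_{m=i+1}^{j+1}\sigma_{i,j,m,n}$, $B_{i,j}=\sum_{m=1}^{i-1}\sum_{n=i-1}^{j-1}\sigma_{m,n,i,j}$ for $[i,j]\in\mathcal T\setminus\{[1,N]\}$; $A_{i,j}=\sum_{k=i}^{j-1}\sum_{l=i+1}^{k+1}\sigma_{i,k,l,j}$ for $[i,j]\in\mathcal P$. CG06 (Caballero and Grossmann 2006), in variables $(\zeta,\sigma,\eta)$: $A_{i,j}\le1$ for $[i,j]\in\mathcal P$; $D_{i,j}\le1$ and $B_{i,j}\le1$ for $[i,j]\in\mathcal T\setminus\{[1,N]\}$; $\sum_{m=1}^{i-1}\sigma_{m,i-1,i,i}+\sum_{n=i+1}^{N}\sigma_{i,i,i+1,n}\ge1$ for $1\le i\le N$; for $[i,j]\in\mathcal S$: $\sigma_{i,j,m,n}\le A_{i,j}$ ($i+1\le m\le j+1$, $j+1\le n\le N$), $\sigma_{m,n,i,j}\le A_{i,j}$ ($1\le m\le i-1$, $i-1\le n\le j-1$), and $\sigma_{i,k,l,j}\le D_{i,j}+B_{i,j}$ ($i\le k\le j-1$, $i+1\le l\le k+1$); for $[i,j]\in\mathcal P$: $\sigma_{i,k,l,j}\le\zeta_{i,j}$ ($i\le k\le j-1$, $i+1\le l\le k+1$) and $A_{i,j}\ge\zeta_{i,j}$; $1-\eta_{i,i}\le\sum_{m=1}^{i-1}\sigma_{m,i-1,i,i}$ for $(i,i)\in\mathcal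 C$; $1-\eta_{i,i}\le\sum_{n=i+1}^{N}\sigma_{i,i,i+1,n}$ for $(i,i)\in\mathcal R$; $\eta_{i,j}\le(1-\sigma_{m,n,i,j})+(1-\sigma_{i,j,m',n'})$ for $[i,j]\in\mathcal T\setminus\{[1,N]\}$, $1\le m\le i-1$, $i-1\le n\le j-1$, $i+1\le m'\le j+1$, $j+1\le n'\le N$; $\eta_{i,j}\le D_{i,j}+B_{i,j}$ for $[i,j]\in\mathcal T\setminus\{[1,N]\}$. GA10 (Giridhar and Agrawal 2010), in variables $(\tau,\beta)$: $\sum_{l=i+1}^{j}\beta_{i,l,j}=\sum_{k=i}^{j-1}\tau_{i,k,j}\le1$ for $[i,j]\in\mathcal P$; for $[i,j]\in\mathcal S$: $\sum_{n=j+1}^{N}\tau_{i,j,n}\le\sum_{k=i}^{j-1}\tau_{i,k,j}$, $\sum_{m=1}^{i-1}\beta_{m,i,j}\le\sum_{k=i}^{j-1}\tau_{i,k,j}$, $\sum_{k=i}^{j-1}\tau_{i,k,j}\le\sum_{n=j+1}^{N}\tau_{i,j,n}+\sum_{m=1}^{i-1}\beta_{m,i,j}$, and $(j-i+1)\max\bigl\{\sum_{m=1}^{i-1}\beta_{m,i,j},\sum_{n=j+1}^{N}\tau_{i,j,n}\bigr\}\le\sum_{l=i+1}^{j}(j-l+1)\beta_{i,l,j}+\sum_{k=i}^{j-1}(k-i+1)\tau_{i,k,j}$; $\sum_{n=j+1}^{N}\tau_{i,j,n}\le1$ and $\sum_{m=1}^{i-1}\beta_{m,i,j}\le1$ for $[i,j]\in\mathcal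 T\setminus\{[1,N]\}$; $\sum_{n=i+1}^{N}\tau_{i,i,n}+\sum_{m=1}^{i-1}\beta_{m,i,i}\ge1$ for $1\le i\le N$. TAT19 (Tumbalam Gooty, Agrawal, Tawarmalani 2019), in variables $(\zeta,\chi,\rho)$ (with $\chi_{i,j}$, resp. $\rho_{i,j}$, read as $0$ when not defined): $\zeta_{1,N}=\zeta_{i,i}=1$ for $1\le i\le N$; $\zeta_{i,j}\le\sum_{n=j+1}^{N}\zeta_{i,n}+\sum_{m=1}^{i-1}\zeta_{m,j}$ for $[i,j]\in\mathcal T\setminus\{[1,N]\}$; for $[i,j]\in\mathcal P$: $\zeta_{i,k}-\sum_{n=k+1}^{j-1}\zeta_{i,n}+\zeta_{i,j}-1\le\sum_{l=i+1}^{k+1}\zeta_{l,j}$ ($i\le k\le j-1$) and $\zeta_{i,j}-\sum_{m=i+1}^{l-1}\zeta_{m,j}+\zeta_{l,j}-1\le\sum_{k=l-1}^{j-1}\zeta_{i,k}$ ($i+1\le l\le j$); $\chi_{i,j}+\rho_{i,j}\le\zeta_{i,j}$ for $[i,j]\in\mathcal T\setminus\{[1,N]\}$; $\chi_{i,j}\le\sum_{n=j+1}^{N}\zeta_{i,n}$ for $(i,j)\in\mathcal C$; $\rho_{i,j}\le\sum_{m=1}^{i-1}\zeta_{m,j}$ for $(i,j)\in\mathcal R$; $\chi_{i,j}+\rho_{i,j}\le(1-\zeta_{i,n})+(1-\zeta_{m,j})$ for $[i,j]\in\mathcal T$, $1\le m\le i-1$, $j+1\le n\le N$; $\chi_{i,i}\ge1-\sum_{m=1}^{i-1}\zeta_{m,i}$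 for $(i,i)\in\mathcal C$; $\rho_{i,i}\ge1-\sum_{n=i+1}^{N}\zeta_{i,n}$ for $(i,i)\in\mathcal R$. *)

(* Defs.v *)
(* Families of real variables indexed by (subsets of) tuples of
   naturals are total functions on nat, with the 1-based indices of the
   mathematics; every constraint only reads entries inside the index sets (or
   the boundary conventions made explicit below), so the values elsewhere are
   irrelevant. *)
From HB Require Import structures.
From mathcomp Require Import all_boot all_order all_algebra.
Set Implicit Arguments.
Unset Strict Implicit.
Unset Printing Implicit Defensive.
Import Order.TTheory GRing.Theory Num.Theory.
Local Open Scope ring_scope.

Section IndexSets.
Variable N : nat.

Definition inT (i j : nat) : bool := [&& 1 <= i, i <= j & j <= N]%N.
Definition inP (i j : nat) : bool := inT i j && (i != j).
(* T minus [1,N] *)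
Definition inT' (i j : nat) : bool := inT i j && ((i, j) != (1, N)%N).
Definition inS (i j : nat) : bool := inP i j && ((i, j) != (1, N)%N).
Definition inC (i j : nat) : bool := [&& 1 <= i, i <= j & j <= N.-1]%N.
Definition inR (i j : nat) : bool := [&& 2 <= i, i <= j & j <= N]%N.

End IndexSets.

Section Constraints.
Variables (R : realFieldType) (N : nat).

Implicit Types (zeta chi rho eta : nat -> nat -> R).
Implicit Types (tau beta nu omega : nat -> nat -> nat -> R).
Implicit Type (sigma : nat -> nat -> nat -> nat -> R).

(* nu_{i,n,m} and omega_{n,m,j} with the convention that they are 1 when
   n = m + 1. *)
Definition nu_ext nu (i n m : nat) : R :=
  if n == m.+1 then 1 else nu i n m.
Definition omega_ext omega (n m j : nat) : R :=
  if n == m.+1 then 1 else omega n m j.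

(* tau_{i,j,N+1} *)
Definition tau_last nu (i j : nat) : R :=
  nu_ext nu i j.+1 N - nu_ext nu i j N.
(* beta_{0,i,j} *)
Definition beta_first omega (i j : nat) : R :=
  omega_ext omega 1 i.-1 j - omega_ext omega 1 i j.

Definition chi_ext chi (i j : nat) : R := if inC N i j then chi i j else 0.
Definition rho_ext rho (i j : nat) : R := if inR N i j then rho i j else 0.

Definition Dsum sigma (i j : nat) : R :=
  \sum_(j.+1 <= n < N.+1) \sum_(i.+1 <= m < j.+2) sigma i j m n.
Definition Bsum sigma (i j : nat) : R :=
  \sum_(1 <= m < i) \sum_(i.-1 <= n < j) sigma m n i j.
Definition Asum sigma (i j : nat) : R :=
  \sum_(i <= k < j) \sum_(i.+1 <= l < k.+2) sigma i k l j.

Record Sec tau beta nu omega : Prop := {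
  Sec_tau : forall i j k, inP N i j -> (i <= k <= j.-1)%N ->
    tau i k j = nu_ext nu i k.+1 j.-1 - nu_ext nu i k j.-1
                - nu_ext nu i k.+1 j + nu_ext nu i k j;
  Sec_beta : forall i j l, inP N i j -> (i.+1 <= l <= j)%N ->
    beta i l j = omega_ext omega i.+1 l.-1 j - omega_ext omega i l.-1 j
                 - omega_ext omega i.+1 l j + omega_ext omega i l j
}.

Record McC zeta nu omega : Prop := {
  McC_nu_diag : forall i j, inT N i j -> nu i j j = 1 - zeta i j;
  McC_omega_diag : forall i j, inT N i j -> omega i i j = 1 - zeta i j;
  McC_nu : forall i j k m n, inP N i j ->
    (i <= k <= j.-1)%N -> (k <= m <= j.-1)%N -> (k.+1 <= n <= m.+1)%N ->
    Num.max 0 (nu_ext nu i k m + nu_ext nu i n j - nu_ext nu i n m)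
      <= nu_ext nu i k j <= Num.min (nu_ext nu i k m) (nu_ext nu i n j);
  McC_omega : forall i j l m n, inP N i j ->
    (i.+1 <= l <= j)%N -> (i <= m <= l.-1)%N -> (i.+1 <= n <= m.+1)%N ->
    Num.max 0
        (omega_ext omega i m j + omega_ext omega n l j - omega_ext omega n m j)
      <= omega_ext omega i l j
      <= Num.min (omega_ext omega i m j) (omega_ext omega n l j)
}.

Record Feed zeta : Prop := {
  Feed_mix : zeta 1%N N = 1;
  Feed_pure : forall i, (1 <= i <= N)%N -> zeta i i = 1
}.

Record Split tau beta sigma : Prop := {
  Split_tau : forall i j k, inP N i j -> (i <= k <= j.-1)%N ->
    \sum_(i.+1 <= l < k.+2) sigma i k l j = tau i k j;
  Split_beta : forall i j l, inP N i j -> (i.+1 <= l <= j)%N ->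
    \sum_(l.-1 <= k < j) sigma i k l j = beta i l j;
  Split_ge0 : forall i j k l, inP N i j ->
    (i <= k <= j.-1)%N -> (i.+1 <= l <= k.+1)%N -> 0 <= sigma i k l j
}.

Record Hex nu omega chi rho : Prop := {
  Hex_chi : forall i j, inC N i j -> chi i j <= beta_first omega i j;
  Hex_rho : forall i j, inR N i j -> rho i j <= tau_last nu i j;
  Hex_chi_pure : forall i, inC N i i -> chi i i >= beta_first omega i i;
  Hex_rho_pure : forall i, inR N i i -> rho i i >= tau_last nu i i
}.

Definition Pres tau omega : Prop :=
  forall i j, inT' N i j ->
    beta_first omega i j <= \sum_(j.+1 <= n < N.+1) tau i j n.

Record in_F zeta tau beta nu omega sigma chi rho : Prop := {
  F_Sec : Sec tau beta nu omega;
  F_McC : McC zeta nu omega;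
  F_Feed : Feed zeta;
  F_Split : Split tau beta sigma;
  F_Hex : Hex nu omega chi rho;
  F_Pres : Pres tau omega;
  F_zeta : forall i j, inT N i j -> 0 <= zeta i j <= 1;
  F_chi : forall i j, inC N i j -> 0 <= chi i j <= 1;
  F_rho : forall i j, inR N i j -> 0 <= rho i j <= 1
}.

Record CG06 zeta sigma eta : Prop := {
  CG06_A : forall i j, inP N i j -> Asum sigma i j <= 1;
  CG06_D : forall i j, inT' N i j -> Dsum sigma i j <= 1;
  CG06_B : forall i j, inT' N i j -> Bsum sigma i j <= 1;
  CG06_pure : forall i, (1 <= i <= N)%N ->
    \sum_(1 <= m < i) sigma m i.-1 i i
      + \sum_(i.+1 <= n < N.+1) sigma i i i.+1 n >= 1;
  CG06_dist_A : forall i j m n, inS N i j ->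
    (i.+1 <= m <= j.+1)%N -> (j.+1 <= n <= N)%N ->
    sigma i j m n <= Asum sigma i j;
  CG06_bot_A : forall i j m n, inS N i j ->
    (1 <= m <= i.-1)%N -> (i.-1 <= n <= j.-1)%N ->
    sigma m n i j <= Asum sigma i j;
  CG06_DB : forall i j k l, inS N i j ->
    (i <= k <= j.-1)%N -> (i.+1 <= l <= k.+1)%N ->
    sigma i k l j <= Dsum sigma i j + Bsum sigma i j;
  CG06_sigma_zeta : forall i j k l, inP N i j ->
    (i <= k <= j.-1)%N -> (i.+1 <= l <= k.+1)%N -> sigma i k l j <= zeta i j;
  CG06_A_zeta : forall i j, inP N i j -> Asum sigma i j >= zeta i j;
  CG06_eta_C : forall i, inC N i i ->
    1 - eta i i <= \sum_(1 <= m < i) sigma m i.-1 i i;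
  CG06_eta_R : forall i, inR N i i ->
    1 - eta i i <= \sum_(i.+1 <= n < N.+1) sigma i i i.+1 n;
  CG06_eta_sigma : forall i j m n m' n', inT' N i j ->
    (1 <= m <= i.-1)%N -> (i.-1 <= n <= j.-1)%N ->
    (i.+1 <= m' <= j.+1)%N -> (j.+1 <= n' <= N)%N ->
    eta i j <= (1 - sigma m n i j) + (1 - sigma i j m' n');
  CG06_eta_DB : forall i j, inT' N i j ->
    eta i j <= Dsum sigma i j + Bsum sigma i j
}.

Record GA10 tau beta : Prop := {
  GA10_balance : forall i j, inP N i j ->
    \sum_(i.+1 <= l < j.+1) beta i l j = \sum_(i <= k < j) tau i k j;
  GA10_split1 : forall i j, inP N i j -> \sum_(i <= k < j) tau i k j <= 1;
  GA10_dist : forall i j, inS N i j ->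
    \sum_(j.+1 <= n < N.+1) tau i j n <= \sum_(i <= k < j) tau i k j;
  GA10_bot : forall i j, inS N i j ->
    \sum_(1 <= m < i) beta m i j <= \sum_(i <= k < j) tau i k j;
  GA10_made : forall i j, inS N i j ->
    \sum_(i <= k < j) tau i k j
      <= \sum_(j.+1 <= n < N.+1) tau i j n + \sum_(1 <= m < i) beta m i j;
  GA10_weight : forall i j, inS N i j ->
    (j - i + 1)%:R * Num.max (\sum_(1 <= m < i) beta m i j)
                             (\sum_(j.+1 <= n < N.+1) tau i j n)
      <= \sum_(i.+1 <= l < j.+1) (j - l + 1)%:R * beta i l j
         + \sum_(i <= k < j) (k - i + 1)%:R * tau i k j;
  GA10_dist1 : forall i j, inT' N i j ->
    \sum_(j.+1 <= n < N.+1) tau i j n <= 1;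
  GA10_bot1 : forall i j, inT' N i j -> \sum_(1 <= m < i) beta m i j <= 1;
  GA10_pure : forall i, (1 <= i <= N)%N ->
    \sum_(i.+1 <= n < N.+1) tau i i n + \sum_(1 <= m < i) beta m i i >= 1
}.

Record TAT19 zeta chi rho : Prop := {
  TAT19_feed : zeta 1%N N = 1;
  TAT19_pure : forall i, (1 <= i <= N)%N -> zeta i i = 1;
  TAT19_made : forall i j, inT' N i j ->
    zeta i j <= \sum_(j.+1 <= n < N.+1) zeta i n + \sum_(1 <= m < i) zeta m j;
  TAT19_top : forall i j k, inP N i j -> (i <= k <= j.-1)%N ->
    zeta i k - \sum_(k.+1 <= n < j) zeta i n + zeta i j - 1
      <= \sum_(i.+1 <= l < k.+2) zeta l j;
  TAT19_bottom : forall i j l, inP N i j -> (i.+1 <= l <= j)%N ->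
    zeta i j - \sum_(i.+1 <= m < l) zeta m j + zeta l j - 1
      <= \sum_(l.-1 <= k < j) zeta i k;
  TAT19_hex_zeta : forall i j, inT' N i j ->
    chi_ext chi i j + rho_ext rho i j <= zeta i j;
  TAT19_chi : forall i j, inC N i j ->
    chi i j <= \sum_(j.+1 <= n < N.+1) zeta i n;
  TAT19_rho : forall i j, inR N i j ->
    rho i j <= \sum_(1 <= m < i) zeta m j;
  TAT19_hex : forall i j m n, inT N i j ->
    (1 <= m <= i.-1)%N -> (j.+1 <= n <= N)%N ->
    chi_ext chi i j + rho_ext rho i j <= (1 - zeta i n) + (1 - zeta m j);
  TAT19_chi_pure : forall i, inC N i i ->
    chi i i >= 1 - \sum_(1 <= m < i) zeta m i;
  TAT19_rho_pure : forall i, inR N i i ->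
    rho i i >= 1 - \sum_(i.+1 <= n < N.+1) zeta i n
}.

End Constraints.

(* Main.v *)
(* For fixed [i], [nu i a b] stands for the probability that none of the
   [i,a], ..., [i,b] is present, and for fixed [j], [omega a b j] for the
   probability that none of [a,j], ..., [b,j] is present. Both are functions of
   an interval [a..b] obeying the same McCormick inequalities, and tau, beta are
   their mixed second differences. These telescope: the sum of the tau_{i,k,j}
   over k and the sum of the beta_{i,l,j} over l are both zeta_{i,j}, while the
   sums of the tau_{i,j,n} over n and of the beta_{m,i,j} over m equal
   zeta_{i,j} minus tau_{i,j,N+1}, resp. beta_{0,i,j}. These sums are A, D and
   B, so (Pres) says zeta_{i,j} <= D_{i,j} + B_{i,j}, and the remaining
   inequalities compare single terms with such sums, sigma being nonnegative. *)
Require Import Defs.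
From HB Require Import structures.
From mathcomp Require Import all_boot all_order all_algebra.
From mathcomp Require Import zify lra.
Set Implicit Arguments.
Unset Strict Implicit.
Unset Printing Implicit Defensive.
Import Order.TTheory GRing.Theory Num.Theory.
Local Open Scope ring_scope.

(** * Sums over integer intervals *)

Lemma ler_term_sum_nat (R : numDomainType) (m n i : nat) (F : nat -> R) :
  (m <= i < n)%N -> (forall k, (m <= k < n)%N -> 0 <= F k) ->
  F i <= \sum_(m <= k < n) F k.
Proof.
move=> /andP[mi lt_in] F0.
rewrite (big_cat_nat mi (ltnW lt_in)) /= (big_ltn lt_in) addrCA lerDl.
by apply: addr_ge0; rewrite big_nat; apply: sumr_ge0 => k kP; apply: F0; lia.
Qed.

(** Both sides run over the triangle [i < l <= k + 1 <= j]. This reconciles the groupings of [sigma]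
    in [Split_beta] and [Split_tau]. *)
Lemma exchange_big_triangle (R : nmodType) (i j : nat) (F : nat -> nat -> R) :
  \sum_(i.+1 <= l < j.+1) \sum_(l.-1 <= k < j) F k l =
  \sum_(i <= k < j) \sum_(i.+1 <= l < k.+2) F k l.
Proof.
(* The range of [k] must not depend on [l] before the exchange, so [l.-1 <= k] is turned into a side
   condition. *)
under eq_big_nat => l lP.
  rewrite (big_nat_widenl l.-1 i); last lia.
  over.
rewrite (exchange_big_dep_nat xpredT) //=; apply: eq_big_nat => k kP.
rewrite [RHS](big_nat_widen i.+1 k.+2 j.+1); last lia.
by apply: eq_bigl => l; apply/idP/idP; lia.
Qed.

(** * Calculus of interval functions under McCormick inequalities *)

Section IntervalMcCormick.
Variable R : realFieldType.
Implicit Types (z : nat -> R) (F : nat -> nat -> R) (lo hi a b n : nat).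

(* [F a b] mimics the product of the [1 - z n] for [a <= n <= b]. *)
Record interval_mccormick lo hi z F : Prop := {
  im_lo_gt0 : (0 < lo)%N;
  im_empty : forall n, F n.+1 n = 1;
  im_diag : forall a, (lo <= a <= hi)%N -> F a a = 1 - z a;
  im_ge0 : forall a b, (lo <= a < b)%N -> (b <= hi)%N -> 0 <= F a b;
  im_ge : forall a b m n, (lo <= a)%N -> (b <= hi)%N ->
    (a <= m < b)%N -> (a < n <= m.+1)%N -> F a m + F n b - F n m <= F a b;
  im_lel : forall a b m, (lo <= a)%N -> (b <= hi)%N ->
    (a <= m < b)%N -> F a b <= F a m;
  im_ler : forall a b n, (lo <= a)%N -> (b <= hi)%N ->
    (a < n <= b)%N -> F a b <= F n b }.

(** For the exact product and [a < b] this is [z a * z b] times the [1 - z n] with [a < n < b]: both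
    ends present, nothing in between. *)
Definition mixed_diff F a b : R := F a.+1 b.-1 - F a b.-1 - F a.+1 b + F a b.

Variables (lo hi : nat) (z : nat -> R) (F : nat -> nat -> R).
Hypothesis imF : interval_mccormick lo hi z F.

(** The summand is the increment from [b.-1] to [b] of [F a b - F a.+1 b], whose value at [b = a] is
    [- z a] because [F a.+1 a = 1]. *)
Lemma mixed_diff_sumr a : (lo <= a <= hi)%N ->
  \sum_(a.+1 <= b < hi.+1) mixed_diff F a b = z a - (F a.+1 hi - F a hi).
Proof.
move=> aP; rewrite big_add1 /= /mixed_diff.
rewrite (eq_bigr (fun b => (F a b.+1 - F a.+1 b.+1) - (F a b - F a.+1 b)));
  last by move=> b _ /=; lra.
rewrite (telescope_sumr (fun b => F a b - F a.+1 b)); last lia.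
by rewrite (im_empty imF) (im_diag imF) //; lra.
Qed.

Lemma mixed_diff_suml b : (lo <= b <= hi)%N ->
  \sum_(lo <= a < b) mixed_diff F a b = z b - (F lo b.-1 - F lo b).
Proof.
move=> bP; rewrite /mixed_diff.
rewrite (eq_bigr (fun a => (F a.+1 b.-1 - F a.+1 b) - (F a b.-1 - F a b)));
  last by move=> a _ /=; lra.
rewrite (telescope_sumr (fun a => F a b.-1 - F a b)); last lia.
have lo_gt0 := im_lo_gt0 imF.
have b_gt0 : (0 < b)%N by lia.
have -> : F b b.-1 = 1 by rewrite -{1}(prednK b_gt0) (im_empty imF).
by rewrite (im_diag imF) //; lra.
Qed.

(** [F lo b] is squeezed between [0] and [F lo lo = 1 - z lo]. This kills the boundary terms of
    telescoped sums. *)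
Lemma im_lo_eq0 b : z lo = 1 -> (lo <= b <= hi)%N -> F lo b = 0.
Proof.
move=> zlo bP.
have F0 : F lo lo = 0 by rewrite (im_diag imF) ?zlo ?subrr //; lia.
have [->//|b_neq] := eqVneq b lo; apply/eqP; rewrite eq_le.
by rewrite (im_ge0 imF) ?andbT -?F0 ?(im_lel imF) //; lia.
Qed.

Lemma im_hi_eq0 a : z hi = 1 -> (lo <= a <= hi)%N -> F a hi = 0.
Proof.
move=> zhi aP.
have F0 : F hi hi = 0 by rewrite (im_diag imF) ?zhi ?subrr //; lia.
have [->//|a_neq] := eqVneq a hi; apply/eqP; rewrite eq_le.
by rewrite (im_ge0 imF) ?andbT -?F0 ?(im_ler imF) //; lia.
Qed.

Hypothesis z01 : forall n, (lo <= n <= hi)%N -> 0 <= z n <= 1.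

Lemma im_hi_diff_ge0 a : (lo <= a <= hi)%N -> 0 <= F a.+1 hi - F a hi.
Proof.
(* At [a = hi] the convention [F hi.+1 hi = 1] makes the difference [z hi]; below [hi], monotonicity
   applies. *)
move=> aP; have [->|a_neq] := eqVneq a hi.
  by rewrite (im_empty imF) (im_diag imF); [have := @z01 hi ltac:(lia); lra|]; lia.
by rewrite subr_ge0 (im_ler imF) //; lia.
Qed.

Lemma im_lo_diff_ge0 b : (lo <= b <= hi)%N -> 0 <= F lo b.-1 - F lo b.
Proof.
move=> bP; have lo_gt0 := im_lo_gt0 imF.
have [->|b_neq] := eqVneq b lo.
  have -> : F lo lo.-1 = 1 by rewrite -{1}(prednK lo_gt0) (im_empty imF).
  by rewrite (im_diag imF); [have := @z01 lo ltac:(lia); lra|]; lia.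
by rewrite subr_ge0 (im_lel imF) //; lia.
Qed.

Lemma im_ge0_diag a b : (lo <= a <= b)%N -> (b <= hi)%N -> 0 <= F a b.
Proof.
move=> ab bhi; have [->|b_neq] := eqVneq a b.
  by rewrite (im_diag imF); [have := @z01 b ltac:(lia); lra|lia].
by rewrite (im_ge0 imF) //; lia.
Qed.

(** Monotonicity shrinks the interval from each end down to the single index [n]. *)
Lemma im_le_diag a b n : (lo <= a)%N -> (b <= hi)%N -> (a <= n <= b)%N ->
  F a b <= 1 - z n.
Proof.
move=> aP bP nP; rewrite -(im_diag imF); last lia.
apply: (@le_trans _ _ (F n b)).
  by have [->//|n_neq] := eqVneq a n; rewrite (im_ler imF) //; lia.
by have [->//|n_neq] := eqVneq n b; rewrite (im_lel imF) //; lia.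
Qed.

Lemma im_hi_diff_le a n : (lo <= a < n)%N -> (n <= hi)%N ->
  F a.+1 hi - F a hi <= 1 - z n.
Proof.
move=> an nhi; have : 0 <= F a hi by rewrite im_ge0_diag //; lia.
by have : F a.+1 hi <= 1 - z n; [rewrite im_le_diag //; lia | lra].
Qed.

Lemma im_lo_diff_le b n : (lo <= n < b)%N -> (b <= hi)%N ->
  F lo b.-1 - F lo b <= 1 - z n.
Proof.
move=> nb bhi; have : 0 <= F lo b by rewrite im_ge0_diag //; lia.
by have : F lo b.-1 <= 1 - z n; [rewrite im_le_diag //; lia | lra].
Qed.

(** The union bound, by induction on [b]: splitting off the last index with [im_ge] costs [z b.+1],
    as the overlap [F b.+1 b] equals [1]. *)
Lemma im_union_bound a b : (lo <= a <= b.+1)%N -> (b <= hi)%N ->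
  1 - \sum_(a <= n < b.+1) z n <= F a b.
Proof.
elim: b => [|b IHb] aP bP.
  have lo_gt0 := im_lo_gt0 imF.
  (* As [lo] is positive, [b = 0] leaves only the empty interval. *)
  have -> : a = 1%N by lia.
  by rewrite big_geq // subr0 (im_empty imF).
have [->|a_neq] := eqVneq a b.+2; first by rewrite big_geq // subr0 (im_empty imF).
have [->|a_neq'] := eqVneq a b.+1.
  by rewrite big_nat1 (im_diag imF) //; lia.
rewrite big_nat_recr /=; last lia.
have := IHb ltac:(lia) ltac:(lia).
have := @im_ge _ _ _ _ imF a b.+1 b b.+1 ltac:(lia) bP ltac:(lia) ltac:(lia).
rewrite (im_empty imF) (im_diag imF); last lia.
by lra.
Qed.

(** Each of the four values of [F] is estimated separately: the inner one by the union bound, those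
    with one extra end by [im_le_diag], and [F a b] by [0]. *)
Lemma mixed_diff_ge a b : (lo <= a < b)%N -> (b <= hi)%N ->
  z a - \sum_(a.+1 <= n < b) z n + z b - 1 <= mixed_diff F a b.
Proof.
move=> ab bhi; rewrite /mixed_diff.
have := @im_union_bound a.+1 b.-1 ltac:(lia) ltac:(lia).
have -> : b.-1.+1 = b by lia.
have := @im_le_diag a b.-1 a ltac:(lia) ltac:(lia) ltac:(lia).
have := @im_le_diag a.+1 b b ltac:(lia) ltac:(lia) ltac:(lia).
have := @im_ge0_diag a b ltac:(lia) ltac:(lia).
by lra.
Qed.

End IntervalMcCormick.

(** * Index sets of the formulation *)

Section Relaxation.
Variables (R : realFieldType) (N : nat).
Variables (zeta : nat -> nat -> R) (tau beta nu omega : nat -> nat -> nat -> R).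
Variables (sigma : nat -> nat -> nat -> nat -> R) (chi rho : nat -> nat -> R).
Hypothesis hN : (2 <= N)%N.
Hypothesis inF : in_F N zeta tau beta nu omega sigma chi rho.

Lemma inP_T i j : inP N i j -> inT N i j. Proof. by case/andP. Qed.
Lemma inT'_T i j : inT' N i j -> inT N i j. Proof. by case/andP. Qed.
Lemma inS_P i j : inS N i j -> inP N i j. Proof. by case/andP. Qed.
Lemma inS_T' i j : inS N i j -> inT' N i j.
Proof. by case/andP=> /andP[ij _] n1N; apply/andP. Qed.

Lemma inPE i j : inP N i j = [&& 1 <= i, i < j & j <= N]%N.
Proof. by rewrite /inP /inT; apply/idP/idP; lia. Qed.
Lemma inT'_C i j : inC N i j -> inT' N i j.
Proof. by rewrite /inT' /inT /inC xpair_eqE; lia. Qed.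
Lemma inT'_R i j : inR N i j -> inT' N i j.
Proof. by rewrite /inT' /inT /inR xpair_eqE; lia. Qed.
Lemma inT'_pure i : (1 <= i <= N)%N -> inT' N i i.
Proof. by rewrite /inT' /inT xpair_eqE; lia. Qed.

Lemma zeta_le1 i j : inT N i j -> zeta i j <= 1.
Proof. by case/(F_zeta inF)/andP. Qed.

(** * [nu] and [omega] as interval functions *)

Lemma nu_mccormick i : (1 <= i <= N)%N ->
  interval_mccormick i N (zeta i) (nu_ext nu i).
Proof.
move=> iP.
have nuP a b m n : (i <= a)%N -> (b <= N)%N -> (a <= m < b)%N ->
    (a < n <= m.+1)%N ->
    [/\ 0 <= nu_ext nu i a b,
        nu_ext nu i a m + nu_ext nu i n b - nu_ext nu i n m <= nu_ext nu i a b,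
        nu_ext nu i a b <= nu_ext nu i a m & nu_ext nu i a b <= nu_ext nu i n b].
  (* With the row [i] fixed, the constraint is read at [[i, b]], with [a] as its [k]. *)
  move=> ia bN mP nP; have ib : inP N i b by rewrite inPE; lia.
  have := @McC_nu _ _ _ _ _ (F_McC inF) i b a m n ib ltac:(lia) ltac:(lia) nP.
  by rewrite ge_max le_min => /andP[/andP[-> ->] /andP[-> ->]].
split=> //; first by lia.
- by move=> n; rewrite /nu_ext eqxx.
- move=> a aP; rewrite /nu_ext ifF; last by lia.
  by rewrite (McC_nu_diag (F_McC inF)) // /inT; lia.
- by move=> a b ab bN; case: (@nuP a b a a.+1) => //; lia.
- by move=> a b m n ia bN mP nP; case: (@nuP a b m n).
(* Monotonicity involves only one of [m] and [n]; the other is set to an admissible value. *)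
- by move=> a b m ia bN mP; case: (@nuP a b m a.+1) => //; lia.
- by move=> a b n ia bN nP; case: (@nuP a b n.-1 n) => //; lia.
Qed.

(** With the column [j] fixed, the constraint is read at [[a, j]], with [b] as its [l]. *)
Lemma omega_mccormick j : (1 <= j <= N)%N ->
  interval_mccormick 1 j (zeta^~ j) (fun a b => omega_ext omega a b j).
Proof.
move=> jP; pose G a b := omega_ext omega a b j.
have omP a b m n : (1 <= a)%N -> (b <= j)%N -> (a <= m < b)%N ->
    (a < n <= m.+1)%N ->
    [/\ 0 <= G a b, G a m + G n b - G n m <= G a b,
        G a b <= G a m & G a b <= G n b].
  move=> a1 bj mP nP; have aj : inP N a j by rewrite inPE; lia.
  have := @McC_omega _ _ _ _ _ (F_McC inF) a j b m n aj
    ltac:(lia) ltac:(lia) ltac:(lia).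
  by rewrite ge_max le_min => /andP[/andP[-> ->] /andP[-> ->]].
split=> //.
- by move=> n; rewrite /omega_ext eqxx.
- move=> a aP; rewrite /omega_ext ifF; last by lia.
  by rewrite (McC_omega_diag (F_McC inF)) // /inT; lia.
- by move=> a b ab bN; case: (@omP a b a a.+1) => //; lia.
- by move=> a b m n ia bN mP nP; case: (@omP a b m n).
- by move=> a b m ia bN mP; case: (@omP a b m a.+1) => //; lia.
- by move=> a b n ia bN nP; case: (@omP a b n.-1 n) => //; lia.
Qed.

Lemma zeta_row01 i : (1 <= i)%N ->
  forall n, (i <= n <= N)%N -> 0 <= zeta i n <= 1.
Proof. by move=> iP n nP; rewrite (F_zeta inF) // /inT; lia. Qed.

Lemma zeta_col01 j : (j <= N)%N ->
  forall n, (1 <= n <= j)%N -> 0 <= zeta n j <= 1.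
Proof. by move=> jP n nP; rewrite (F_zeta inF) // /inT; lia. Qed.

(** * Telescoped sums of [tau] and [beta] *)

Lemma tauE i k j : (1 <= i <= k)%N -> (k < j <= N)%N ->
  tau i k j = mixed_diff (nu_ext nu i) k j.
Proof. by move=> ik kj; rewrite (Sec_tau (F_Sec inF)) ?inPE //; lia. Qed.

Lemma betaE i l j : (1 <= i < l)%N -> (l <= j <= N)%N ->
  beta i l j = mixed_diff (fun a b => omega_ext omega a b j) i l.
Proof. by move=> il lj; rewrite (Sec_beta (F_Sec inF)) ?inPE //; lia. Qed.

(** Both boundary values left by telescoping vanish because [zeta i i = 1]. *)
Lemma sum_tau i j : inP N i j -> \sum_(i <= k < j) tau i k j = zeta i j.
Proof.
rewrite inPE => ij.
rewrite (eq_big_nat _ _ (F2 := fun k => mixed_diff (nu_ext nu i) k j));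
  last by move=> k kP; rewrite tauE //; lia.
have zi : zeta i i = 1 by rewrite (Feed_pure (F_Feed inF)) //; lia.
have im := @nu_mccormick i ltac:(lia).
rewrite (mixed_diff_suml im); last lia.
by rewrite !(im_lo_eq0 im zi) ?subr0 //; lia.
Qed.

Lemma sum_beta i j : inP N i j -> \sum_(i.+1 <= l < j.+1) beta i l j = zeta i j.
Proof.
rewrite inPE => ij.
rewrite (eq_big_nat _ _
  (F2 := fun l => mixed_diff (fun a b => omega_ext omega a b j) i l));
  last by move=> l lP; rewrite betaE //; lia.
have zj : zeta j j = 1 by rewrite (Feed_pure (F_Feed inF)) //; lia.
have im := @omega_mccormick j ltac:(lia).
rewrite (mixed_diff_sumr im); last lia.
by rewrite !(im_hi_eq0 im zj) ?subr0 //; lia.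
Qed.

(** Telescoping up to [N] leaves exactly the difference that defines [tau_last]. *)
Lemma sum_tau_out i j : inT N i j ->
  \sum_(j.+1 <= n < N.+1) tau i j n = zeta i j - tau_last N nu i j.
Proof.
rewrite /inT => ij.
rewrite (eq_big_nat _ _ (F2 := fun n => mixed_diff (nu_ext nu i) j n));
  last by move=> n nP; rewrite tauE //; lia.
by rewrite (mixed_diff_sumr (@nu_mccormick i ltac:(lia))) //; lia.
Qed.

Lemma sum_beta_out i j : inT N i j ->
  \sum_(1 <= m < i) beta m i j = zeta i j - beta_first omega i j.
Proof.
rewrite /inT => ij.
rewrite (eq_big_nat _ _
  (F2 := fun m => mixed_diff (fun a b => omega_ext omega a b j) m i));
  last by move=> m mP; rewrite betaE //; lia.
by rewrite (mixed_diff_suml (@omega_mccormick j ltac:(lia))) //; lia.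
Qed.

Lemma tau_last_ge0 i j : inT N i j -> 0 <= tau_last N nu i j.
Proof.
rewrite /inT => ij; have im := @nu_mccormick i ltac:(lia).
by rewrite (im_hi_diff_ge0 im) //; [apply: zeta_row01|]; lia.
Qed.

Lemma beta_first_ge0 i j : inT N i j -> 0 <= beta_first omega i j.
Proof.
rewrite /inT => ij; have im := @omega_mccormick j ltac:(lia).
by rewrite (im_lo_diff_ge0 im) //; [apply: zeta_col01|]; lia.
Qed.

(** * Comparisons between [sigma], [tau], [beta] and [zeta] *)

Lemma sigma_ge0 i k l j : (1 <= i < l)%N -> (l <= k.+1)%N -> (k < j <= N)%N ->
  0 <= sigma i k l j.
Proof.
by move=> il lk kj; rewrite (Split_ge0 (F_Split inF)) ?inPE //; lia.
Qed.

Lemma sum_sigma_tau i k j : (1 <= i <= k)%N -> (k < j <= N)%N ->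
  \sum_(i.+1 <= l < k.+2) sigma i k l j = tau i k j.
Proof. by move=> ik kj; rewrite (Split_tau (F_Split inF)) ?inPE //; lia. Qed.

Lemma sum_sigma_beta i l j : (1 <= i < l)%N -> (l <= j <= N)%N ->
  \sum_(l.-1 <= k < j) sigma i k l j = beta i l j.
Proof. by move=> il lj; rewrite (Split_beta (F_Split inF)) ?inPE //; lia. Qed.

Lemma sigma_le_tau i k l j :
  (1 <= i < l)%N -> (l <= k.+1)%N -> (k < j <= N)%N ->
  sigma i k l j <= tau i k j.
Proof.
move=> il lk kj; rewrite -sum_sigma_tau //; last lia.
apply: (@ler_term_sum_nat _ _ _ _ (fun l => sigma i k l j)); first lia.
by move=> l' lP; apply: sigma_ge0; lia.
Qed.

Lemma sigma_le_beta i k l j :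
  (1 <= i < l)%N -> (l <= k.+1)%N -> (k < j <= N)%N ->
  sigma i k l j <= beta i l j.
Proof.
move=> il lk kj; rewrite -sum_sigma_beta //; last lia.
apply: (@ler_term_sum_nat _ _ _ _ (fun k => sigma i k l j)); first lia.
by move=> k' kP; apply: sigma_ge0; lia.
Qed.

Lemma tau_ge0 i k j : (1 <= i <= k)%N -> (k < j <= N)%N -> 0 <= tau i k j.
Proof.
move=> ik kj; rewrite -sum_sigma_tau // big_nat.
by apply: sumr_ge0 => l lP; apply: sigma_ge0; lia.
Qed.

Lemma beta_ge0 i l j : (1 <= i < l)%N -> (l <= j <= N)%N -> 0 <= beta i l j.
Proof.
move=> il lj; rewrite -sum_sigma_beta // big_nat.
by apply: sumr_ge0 => k kP; apply: sigma_ge0; lia.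
Qed.

Lemma tau_le_zeta i k j : (1 <= i <= k)%N -> (k < j <= N)%N ->
  tau i k j <= zeta i j.
Proof.
move=> ik kj; rewrite -sum_tau ?inPE; last lia.
apply: (@ler_term_sum_nat _ _ _ _ (fun k => tau i k j)); first lia.
by move=> k' kP; apply: tau_ge0; lia.
Qed.

Lemma beta_le_zeta i l j : (1 <= i < l)%N -> (l <= j <= N)%N ->
  beta i l j <= zeta i j.
Proof.
move=> il lj; rewrite -sum_beta ?inPE; last lia.
apply: (@ler_term_sum_nat _ _ _ _ (fun l => beta i l j)); first lia.
by move=> l' lP; apply: beta_ge0; lia.
Qed.

Lemma tau_le_sum_out i j n : (1 <= i <= j)%N -> (j < n <= N)%N ->
  tau i j n <= \sum_(j.+1 <= n < N.+1) tau i j n.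
Proof.
move=> ij jn; apply: ler_term_sum_nat; first lia.
by move=> n' nP; apply: tau_ge0; lia.
Qed.

Lemma beta_le_sum_out m i j : (1 <= m < i)%N -> (i <= j <= N)%N ->
  beta m i j <= \sum_(1 <= m < i) beta m i j.
Proof.
move=> mi ij; apply: (@ler_term_sum_nat _ _ _ _ (fun m => beta m i j)) => //.
by move=> m' mP; apply: beta_ge0; lia.
Qed.

Lemma sum_tau_out_le i j : inT N i j ->
  \sum_(j.+1 <= n < N.+1) tau i j n <= \sum_(j.+1 <= n < N.+1) zeta i n.
Proof.
rewrite /inT => ij; rewrite !big_nat; apply: ler_sum => n nP.
by apply: tau_le_zeta; lia.
Qed.

Lemma sum_beta_out_le i j : inT N i j ->
  \sum_(1 <= m < i) beta m i j <= \sum_(1 <= m < i) zeta m j.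
Proof.
rewrite /inT => ij; rewrite !big_nat; apply: ler_sum => n nP.
by apply: beta_le_zeta; lia.
Qed.

(** While [beta_le_zeta] bounds by the mixture [[m, j]] being split, this bounds by its bottom
    product [[i, j]]. *)
Lemma beta_le_zeta_out m i j : (1 <= m < i)%N -> (i <= j <= N)%N ->
  beta m i j <= zeta i j.
Proof.
move=> mi ij; have T : inT N i j by rewrite /inT; lia.
have := beta_first_ge0 T; have := beta_le_sum_out mi ij.
by rewrite sum_beta_out //; lra.
Qed.

Lemma tau_le_zeta_out i j n : (1 <= i <= j)%N -> (j < n <= N)%N ->
  tau i j n <= zeta i j.
Proof.
move=> ij jn; have T : inT N i j by rewrite /inT; lia.
have := tau_last_ge0 T; have := tau_le_sum_out ij jn.
by rewrite sum_tau_out //; lra.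
Qed.

(** (Pres) with its sum evaluated, which makes it symmetric in the two boundary terms. *)
Lemma beta_first_tau_last_le i j : inT' N i j ->
  beta_first omega i j + tau_last N nu i j <= zeta i j.
Proof.
move=> ij; have := F_Pres inF ij.
by rewrite sum_tau_out ?inT'_T //; lra.
Qed.

(** * Values of A, D, B and bounds on [chi], [rho] *)

Lemma AsumE i j : inP N i j -> Asum sigma i j = zeta i j.
Proof.
move=> ij; rewrite -sum_tau //; apply: eq_big_nat => k kP.
by rewrite sum_sigma_tau //; move: ij; rewrite inPE; lia.
Qed.

Lemma DsumE i j : inT N i j -> Dsum N sigma i j = zeta i j - tau_last N nu i j.
Proof.
move=> ij; rewrite -sum_tau_out //; apply: eq_big_nat => n nP.
by rewrite sum_sigma_tau //; move: ij; rewrite /inT; lia.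
Qed.

Lemma BsumE i j : inT N i j -> Bsum sigma i j = zeta i j - beta_first omega i j.
Proof.
move=> ij; rewrite -sum_beta_out //; apply: eq_big_nat => m mP.
by rewrite sum_sigma_beta //; move: ij; rewrite /inT; lia.
Qed.

Lemma Dsum_pure i : Dsum N sigma i i = \sum_(i.+1 <= n < N.+1) sigma i i i.+1 n.
Proof. by apply: eq_bigr => n _; rewrite big_nat1. Qed.

Lemma Bsum_pure i : (0 < i)%N ->
  Bsum sigma i i = \sum_(1 <= m < i) sigma m i.-1 i i.
Proof. by move=> i0; apply: eq_bigr => m _; rewrite -{2}(prednK i0) big_nat1. Qed.

Lemma chi_ext_le i j : inT N i j -> chi_ext N chi i j <= beta_first omega i j.
Proof.
move=> ij; rewrite /chi_ext; case: ifP => [|_]; first exact: (Hex_chi (F_Hex inF)).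
exact: beta_first_ge0.
Qed.

Lemma rho_ext_le i j : inT N i j -> rho_ext N rho i j <= tau_last N nu i j.
Proof.
move=> ij; rewrite /rho_ext; case: ifP => [|_]; first exact: (Hex_rho (F_Hex inF)).
exact: tau_last_ge0.
Qed.

Lemma chi_ext_ge0 i j : 0 <= chi_ext N chi i j.
Proof. by rewrite /chi_ext; case: ifP => // /(F_chi inF)/andP[]. Qed.

Lemma rho_ext_ge0 i j : 0 <= rho_ext N rho i j.
Proof. by rewrite /rho_ext; case: ifP => // /(F_rho inF)/andP[]. Qed.

(** * The CG06 constraints *)

Lemma relax_CG06 :
  CG06 N zeta sigma (fun i j => chi_ext N chi i j + rho_ext N rho i j).
Proof.
split.
- by move=> i j ij; rewrite AsumE // zeta_le1 // inP_T.
- move=> i j /inT'_T ij; rewrite DsumE //.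
  by have := tau_last_ge0 ij; have := zeta_le1 ij; lra.
- move=> i j /inT'_T ij; rewrite BsumE //.
  by have := beta_first_ge0 ij; have := zeta_le1 ij; lra.
- move=> i iP; have ii := inT'_pure iP; have T := inT'_T ii.
  rewrite -Dsum_pure -Bsum_pure; last lia.
  have := beta_first_tau_last_le ii.
  by rewrite DsumE // BsumE // (Feed_pure (F_Feed inF)) //; lra.
- move=> i j m n ij mP nP; rewrite AsumE ?inS_P //.
  move/inS_P: ij; rewrite inPE => ij.
  by apply: le_trans (sigma_le_tau _ _ _) (tau_le_zeta_out _ _); lia.
- move=> i j m n ij mP nP; rewrite AsumE ?inS_P //.
  move/inS_P: ij; rewrite inPE => ij.
  by apply: le_trans (sigma_le_beta _ _ _) (beta_le_zeta_out _ _); lia.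
(* D + B is [2 * zeta i j] minus boundary terms totalling at most [zeta i j], so it dominates
   [zeta i j]. *)
- move=> i j k l ijS kP lP; have ijT := inS_T' ijS; have T := inT'_T ijT.
  have := beta_first_tau_last_le ijT; rewrite DsumE // BsumE //.
  have : sigma i k l j <= zeta i j; last lra.
  move/inS_P: ijS; rewrite inPE => ij.
  by apply: le_trans (sigma_le_tau _ _ _) (tau_le_zeta _ _); lia.
- move=> i j k l; rewrite inPE => ij kP lP.
  by apply: le_trans (sigma_le_tau _ _ _) (tau_le_zeta _ _); lia.
- by move=> i j ij; rewrite AsumE.
- move=> i ii; have T := inT'_T (inT'_C ii).
  have i0 : (0 < i)%N by case/and3P: ii.
  rewrite -Bsum_pure // BsumE // (Feed_pure (F_Feed inF)); last first.
    by move: T; rewrite /inT; lia.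
  have := Hex_chi_pure (F_Hex inF) ii; have := rho_ext_ge0 i i.
  by rewrite /chi_ext ii; lra.
- move=> i ii; have T := inT'_T (inT'_R ii).
  rewrite -Dsum_pure // DsumE // (Feed_pure (F_Feed inF)); last first.
    by move: T; rewrite /inT; lia.
  have := Hex_rho_pure (F_Hex inF) ii; have := chi_ext_ge0 i i.
  by rewrite /rho_ext ii; lra.
(* Since [zeta i j <= 1], the two differences [1 - sigma] dominate [beta_first] and [tau_last],
   which dominate [chi] and [rho]. *)
- move=> i j m n m' n' /inT'_T T mP nP m'P n'P.
  have := chi_ext_le T; have := rho_ext_le T; have := zeta_le1 T.
  have ij : (1 <= i <= j)%N && (j <= N)%N by move: T; rewrite /inT; lia.
  have : sigma m n i j <= zeta i j - beta_first omega i j.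
    rewrite -sum_beta_out //.
    by apply: le_trans (sigma_le_beta _ _ _) (beta_le_sum_out _ _); lia.
  have : sigma i j m' n' <= zeta i j - tau_last N nu i j.
    rewrite -sum_tau_out //.
    by apply: le_trans (sigma_le_tau _ _ _) (tau_le_sum_out _ _); lia.
  by lra.
- move=> i j ij; have T := inT'_T ij; rewrite DsumE // BsumE //.
  have := chi_ext_le T; have := rho_ext_le T.
  by have := beta_first_tau_last_le ij; lra.
Qed.

(* Both sides are weighted sums of the [sigma i k l j], and [l <= k + 1] makes
   the weight [(j - l + 1) + (k - i + 1)] at least [j - i + 1]. *)
Lemma weighted_split_ge i j : inP N i j ->
  (j - i + 1)%:R * zeta i j <=
  \sum_(i.+1 <= l < j.+1) (j - l + 1)%:R * beta i l j
  + \sum_(i <= k < j) (k - i + 1)%:R * tau i k j.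
Proof.
move=> ijP; rewrite -AsumE //; move: ijP; rewrite inPE => ij.
rewrite (eq_big_nat _ _ (F2 := fun l =>
  \sum_(l.-1 <= k < j) (j - l + 1)%:R * sigma i k l j)); last first.
  by move=> l lP; rewrite -sum_sigma_beta ?mulr_sumr //; lia.
(* Both double sums now have [k] outermost and can be compared term by term. *)
rewrite (exchange_big_triangle i j (fun k l => (j - l + 1)%:R * sigma i k l j)).
rewrite -big_split /= mulr_sumr !big_nat; apply: ler_sum => k kP.
rewrite -sum_sigma_tau; [|lia..].
rewrite !mulr_sumr -big_split /= !big_nat; apply: ler_sum => l lP.
rewrite -mulrDl -natrD ler_wpM2r ?ler_nat //; last lia.
by apply: sigma_ge0; lia.
Qed.

(** * The GA10 constraints *)

Lemma relax_GA10 : GA10 N tau beta.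
Proof.
split.
- by move=> i j ij; rewrite sum_beta // sum_tau.
- by move=> i j ij; rewrite sum_tau // zeta_le1 // inP_T.
- move=> i j ij; have T := inP_T (inS_P ij).
  rewrite sum_tau ?inS_P // sum_tau_out //.
  by have := tau_last_ge0 T; lra.
- move=> i j ij; have T := inP_T (inS_P ij).
  rewrite sum_tau ?inS_P // sum_beta_out //.
  by have := beta_first_ge0 T; lra.
- move=> i j ij; have T := inP_T (inS_P ij).
  rewrite sum_tau ?inS_P // sum_beta_out // sum_tau_out //.
  by have := beta_first_tau_last_le (inS_T' ij); lra.
- move=> i j ij; have T := inP_T (inS_P ij).
  apply: le_trans (weighted_split_ge (inS_P ij)).
  (* Both sums under the maximum are [zeta i j] minus a nonnegative boundary term. *)
  rewrite ler_wpM2l // ge_max sum_beta_out // sum_tau_out //.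
  by have := beta_first_ge0 T; have := tau_last_ge0 T; lra.
- move=> i j /inT'_T T; rewrite sum_tau_out //.
  by have := tau_last_ge0 T; have := zeta_le1 T; lra.
- move=> i j /inT'_T T; rewrite sum_beta_out //.
  by have := beta_first_ge0 T; have := zeta_le1 T; lra.
- move=> i iP; have ii := inT'_pure iP; have T := inT'_T ii.
  have := beta_first_tau_last_le ii.
  by rewrite sum_tau_out // sum_beta_out // (Feed_pure (F_Feed inF)) //; lra.
Qed.

(** * The TAT19 constraints *)

(** Each [sigma i k l j] in [tau i k j] is at most [beta i l j], hence at most [zeta l j]. *)
Lemma tau_le_sum_zeta i k j : (1 <= i <= k)%N -> (k < j <= N)%N ->
  tau i k j <= \sum_(i.+1 <= l < k.+2) zeta l j.
Proof.
move=> ik kj; rewrite -sum_sigma_tau // !big_nat; apply: ler_sum => l lP.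
by apply: le_trans (sigma_le_beta _ _ _) (beta_le_zeta_out _ _); lia.
Qed.

Lemma beta_le_sum_zeta i l j : (1 <= i < l)%N -> (l <= j <= N)%N ->
  beta i l j <= \sum_(l.-1 <= k < j) zeta i k.
Proof.
move=> il lj; rewrite -sum_sigma_beta // !big_nat; apply: ler_sum => k kP.
by apply: le_trans (sigma_le_tau _ _ _) (tau_le_zeta_out _ _); lia.
Qed.

Lemma relax_TAT19 : TAT19 N zeta chi rho.
Proof.
split.
- exact: (Feed_mix (F_Feed inF)).
- exact: (Feed_pure (F_Feed inF)).
- move=> i j ij; have T := inT'_T ij.
  have := beta_first_tau_last_le ij.
  have := sum_tau_out_le T; have := sum_beta_out_le T.
  by rewrite sum_tau_out // sum_beta_out //; lra.
(* [tau i k j] separates the two sides: [mixed_diff_ge] bounds it below, the split into [sigma]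
   above. *)
- move=> i j k; rewrite inPE => ij kP.
  apply: le_trans (@tau_le_sum_zeta i k j _ _); [|lia..].
  rewrite tauE; [|lia..].
  have im := @nu_mccormick i ltac:(lia).
  by apply: (mixed_diff_ge im) => //; [apply: zeta_row01|..]; lia.
- move=> i j l; rewrite inPE => ij lP.
  apply: le_trans (@beta_le_sum_zeta i l j _ _); [|lia..].
  rewrite betaE; [|lia..].
  have im := @omega_mccormick j ltac:(lia).
  by apply: (mixed_diff_ge im) => //; [apply: zeta_col01|..]; lia.
- move=> i j ij; have T := inT'_T ij.
  have := chi_ext_le T; have := rho_ext_le T.
  by have := beta_first_tau_last_le ij; lra.
- move=> i j ij; have T := inT'_T (inT'_C ij).
  apply: le_trans (sum_tau_out_le T).
  exact: le_trans (Hex_chi (F_Hex inF) ij) (F_Pres inF (inT'_C ij)).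
- move=> i j ij; have T := inT'_T (inT'_R ij).
  apply: le_trans (sum_beta_out_le T); rewrite sum_beta_out //.
  have := Hex_rho (F_Hex inF) ij.
  by have := beta_first_tau_last_le (inT'_R ij); lra.
- move=> i j m n T mP nP.
  have := chi_ext_le T; have := rho_ext_le T; move: T; rewrite /inT => ij.
  have : tau_last N nu i j <= 1 - zeta i n.
    have im := @nu_mccormick i ltac:(lia).
    by apply: (im_hi_diff_le im); [apply: zeta_row01|..]; lia.
  have : beta_first omega i j <= 1 - zeta m j.
    have im := @omega_mccormick j ltac:(lia).
    by apply: (im_lo_diff_le im); [apply: zeta_col01|..]; lia.
  by lra.
(* [chi i i] is at least [beta_first], which is [1] minus the sum of the [beta m i i], each at most
   [zeta m i]. *)
- move=> i ii; have T := inT'_T (inT'_C ii).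
  have := Hex_chi_pure (F_Hex inF) ii; have := sum_beta_out_le T.
  rewrite sum_beta_out // (Feed_pure (F_Feed inF)); first lra.
  by move: T; rewrite /inT; lia.
- move=> i ii; have T := inT'_T (inT'_R ii).
  have := Hex_rho_pure (F_Hex inF) ii; have := sum_tau_out_le T.
  rewrite sum_tau_out // (Feed_pure (F_Feed inF)); first lra.
  by move: T; rewrite /inT; lia.
Qed.

End Relaxation.

Theorem proposition7 (R : realFieldType) (N : nat) (hN : (2 <= N)%N)
    (zeta : nat -> nat -> R) (tau beta nu omega : nat -> nat -> nat -> R)
    (sigma : nat -> nat -> nat -> nat -> R) (chi rho : nat -> nat -> R) :
  in_F N zeta tau beta nu omega sigma chi rho ->
  [/\ CG06 N zeta sigma (fun i j => chi_ext N chi i j + rho_ext N rho i j),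
      GA10 N tau beta
    & TAT19 N zeta chi rho].
Proof.
move=> inF; split.
- exact: relax_CG06 hN inF.
- exact: relax_GA10 hN inF.
- exact: relax_TAT19 hN inF.
Qed.
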